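(* For a strongly zero-dimensional frame $L$, the following are equivalent. (1) $L$ is coole. (2) $L$ is $CL$-coole (that is, $D_\sigma CL=D_\infty CL$). (3) $\mathfrak{B}(\mathrm{Coz}\,L)$ is a frame. (4) $\lambda L$ is coole. (5) $\beta L$ is coole.
   Context: For a frame $L$, $a^*$ denotes the pseudocomplement of $a$, $CL$ the Boolean algebra of complemented elements, and $\mathfrak{B}L=\{x\in L:x=x^{**}\}$ the Booleanization; for $S\subseteq L$, $\mathfrak{B}S=\{s^{**}:s\in S\}$. $x\prec\!\!\prec y$ (completely below) means there are $c_q$ ($q\in\mathbb{Q}\cap[0,1]$) with $c_0=x$, $c_1=y$, and $c_p^*\vee c_q=1$ for $p<q$. For completely regular $L$, $\mathrm{Coz}\,L$ is the $\sigma$-frame of cozero elements, i.e. elements of the form $\bigvee\{a_n:n\in\mathbb{N}\}$ with $a_n\prec\!\!\prec a_{n+1}$ for all $n$. $L$ is zero-dimensional if every element is a join of elements of $CL$ (such frames are completely regular), and strongly zero-dimensional if moreover every cozero element is a countable join of complemented elements. A frame $L$ is coole if $\mathfrak{B}(\mathrm{Coz}\,L)=\mathfrak{B}L$. ''$\mathfrak{B}(\mathrm{Coz}\,L)$ is a frame'' refers to its own (induced) order. For a meet-semilattice $A$, a subset $G\subseteq A$ is admissible if $\bigvee G$ exists in $A$ and for each $a\in A$ the join $\bigvee\{a\wedge y:y\in G\}$ exists in $A$ and equals $a\wedge\bigvee G$; a downset $E$ of $A$ is a D-ideal if $\bigvee G\in E$ for each admissible $G\subseteq E$; $D_\infty A$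 is the frame of D-ideals under inclusion. $CL$ is identified with the principal downsets in $D_\infty CL$, and $D_\sigma CL$ is the sub-$\sigma$-frame of $D_\infty CL$ generated by $CL$ (closure under finite meets and countable joins, computed in $D_\infty CL$). $\lambda L$, the Lindelöf (regular) coreflection of $L$, is the frame of $\sigma$-ideals of $\mathrm{Coz}\,L$ (downsets closed under countable joins). $\beta L$, the compact regular coreflection of $L$, is the frame of ideals $I$ of $L$ such that each $x\in I$ satisfies $x\prec\!\!\prec y$ for some $y\in I$. *)

(* Defs.v *)
From HB Require Import structures.
From mathcomp Require Import all_boot all_order all_algebra.
From mathcomp Require Import boolp classical_sets functions cardinality.

Set Implicit Arguments.
Unset Strict Implicit.
Unset Printing Implicit Defensive.

Import Order.TTheory.
Local Open Scope classical_set_scope.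
Local Open Scope order_scope.

HB.mixin Record TBDistrLattice_isFrame d T of Order.TBDistrLattice d T := {
  Sup : set T -> T;
  SupP : forall A : set T, isLub A (Sup A);
  meetSup : forall (x : T) (A : set T),
    (x `&` Sup A)%O = Sup [set (x `&` y)%O | y in A];
}.

#[short(type="frameType")]
HB.structure Definition Frame d :=
  { T of TBDistrLattice_isFrame d T & Order.TBDistrLattice d T }.

HB.factory Record POrder_isFrame d T of Order.POrder d T := {
  fmeet : T -> T -> T;
  ftop : T;
  fSup : set T -> T;
  fmeetP : forall x y z, (x <= fmeet y z) = (x <= y) && (x <= z);
  ftopP : forall x, x <= ftop;
  fSupP : forall A : set T, isLub A (fSup A);
  fmeetSup : forall (x : T) (A : set T),
    fmeet x (fSup A) <= fSup [set fmeet x y | y in A];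
}.

HB.builders Context d T of POrder_isFrame d T.

Let fjoin (x y : T) : T := fSup [set x; y].

Fact fjoinP x y z : (fjoin x y <= z) = (x <= z) && (y <= z).
Proof.
have [ub lub] := fSupP [set x; y].
apply/idP/andP => [xyz|[xz yz]].
  by split; apply: le_trans xyz; apply: ub; [left|right].
by apply: lub => t [->|->].
Qed.

Fact fbotP x : fSup set0 <= x.
Proof. by have [_] := fSupP set0; apply=> y. Qed.

HB.instance Definition _ :=
  Order.POrder_MeetJoin_isLattice.Build d T fmeetP fjoinP.
HB.instance Definition _ := Order.hasBottom.Build d T fbotP.
HB.instance Definition _ := Order.hasTop.Build d T ftopP.

Fact fSup_meet (x : T) (A : set T) :
  (x `&` fSup A)%O = fSup [set (x `&` y)%O | y in A].
Proof.
apply/le_anti/andP; split; first exact: fmeetSup.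
have [_ lub] := fSupP [set (x `&` y)%O | y in A].
apply: lub => _ [y Ay <-]; rewrite lexI leIl /=.
by apply: le_trans (leIr _ _) _; have [ub _] := fSupP A; apply: ub.
Qed.

Fact fmeetUl : left_distributive (@Order.meet d T) (@Order.join d T).
Proof.
move=> x y z; rewrite meetC [LHS]fSup_meet; congr fSup.
apply/seteqP; split=> [_ [_ [->|->] <-]|_ [->|->]].
- by left; rewrite meetC.
- by right; rewrite meetC.
- by exists x; [left|rewrite meetC].
- by exists y; [right|rewrite meetC].
Qed.

HB.instance Definition _ :=
  Order.Lattice_Meet_isDistrLattice.Build d T fmeetUl.
HB.instance Definition _ :=
  TBDistrLattice_isFrame.Build d T fSupP fSup_meet.

HB.end.

Section Subposet.
Context d (T : porderType d).

Definition subposet (S : set T) := {x : T | x \in S}.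

HB.instance Definition _ (S : set T) := SubChoice.on (subposet S).
HB.instance Definition _ (S : set T) :=
  Order.SubChoice_isSubPOrder.Build d T _ d (subposet S).

Definition in_subposet (S : set T) (x : T) (Sx : S x) : subposet S :=
  exist _ x (mem_set Sx).

Lemma subposetP (S : set T) (u : subposet S) : S (val u).
Proof. exact: set_mem (valP u). Qed.

Definition isGlb (A : set T) (m : T) :=
  lbound A m /\ forall b, lbound A b -> b <= m.

(* The top element is the least upper bound of the whole poset. *)
Definition poset_is_frame :=
  [/\ forall A : set T, exists s, isLub A s,
      forall x y : T, exists m, isGlb [set x; y] m
    & forall (x : T) (A : set T) (s m : T), isLub A s -> isGlb [set x; s] m ->
        isLub [set z | exists2 y, A y & isGlb [set x; y] z] m].

End Subposet.

Section FrameNotions.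
Context d (L : frameType d).
Implicit Types (x y : L) (A S I : set L).

Definition pcompl x : L := Sup [set y | x `&` y = \bot].

Definition complemented : set L :=
  [set x | exists2 y, x `&` y = \bot & x `|` y = \top].

Definition booleanization : set L := [set x | x = pcompl (pcompl x)].

Definition bool_image S : set L := [set pcompl (pcompl s) | s in S].

Definition completely_below x y := exists c : rat -> L,
  [/\ c 0%R = x, c 1%R = y &
      forall p q : rat, (0 <= p)%R -> (p < q)%R -> (q <= 1)%R ->
        pcompl (c p) `|` c q = \top].

Definition Coz : set L :=
  [set x | exists2 a : nat -> L,
     forall n, completely_below (a n) (a n.+1) & x = Sup (range a)].

Definition zero_dimensional :=
  forall x, exists2 A, A `<=` complemented & x = Sup A.

Definition strongly_zero_dimensional :=
  zero_dimensional /\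
  forall x, Coz x ->
    exists A, [/\ countable A, A `<=` complemented & x = Sup A].

Definition coole := bool_image Coz = booleanization.

(* [countable] includes the empty set, so that [\bot] belongs to every
   sigma-ideal; countable joins in [Coz] are those of [L] (lemma [Coz_Sup]). *)
Definition sigma_ideal I :=
  [/\ I `<=` Coz,
      forall x y, Coz y -> y <= x -> I x -> I y
    & forall A, countable A -> A `<=` I -> I (Sup A)].

Definition ideal I :=
  [/\ I \bot,
      forall x y, y <= x -> I x -> I y
    & forall x y, I x -> I y -> I (x `|` y)].

Definition regular_ideal I :=
  ideal I /\ forall x, I x -> exists2 y, I y & completely_below x y.

Definition sub_sigma_frame S :=
  [/\ S \top,
      forall x y, S x -> S y -> S (x `&` y)
    & forall A, countable A -> A `<=` S -> S (Sup A)].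

End FrameNotions.

Section FrameFacts.
Context d (L : frameType d).
Implicit Types (x y z : L) (A : set L).

Lemma Sup_ub A x : A x -> x <= Sup A.
Proof. by have [+ _] := SupP A; apply. Qed.

Lemma Sup_le A y : (forall x, A x -> x <= y) -> Sup A <= y.
Proof. by have [_ +] := SupP A; apply. Qed.

Lemma frame_poset_is_frame : poset_is_frame L.
Proof.
have glbE x y m : isGlb [set x; y] m <-> m = x `&` y.
  split=> [[lb glb]|->].
    apply/le_anti; rewrite lexI !lb ?glb//=; [|by right|by left].
    by move=> _ [->|->]; rewrite ?leIl ?leIr.
  split=> [_ [->|->]|b lb]; rewrite ?leIl ?leIr//.
  by rewrite lexI !lb//; [right|left].
split=> [A|x y|x A s m].
- by exists (Sup A); exact: SupP.
- by exists (x `&` y); apply/glbE.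
move=> [ub lub] /glbE ->.
have -> : s = Sup A by apply/le_anti; rewrite (lub _ (@Sup_ub A)) Sup_le.
rewrite meetSup.
suff -> : [set z | exists2 y, A y & isGlb [set x; y] z] =
  [set x `&` y | y in A] by exact: SupP.
by apply/seteqP; split=> z [y Ay]; [move=> /glbE ->|move=> <-];
  exists y => //; apply/glbE.
Qed.

Lemma pcompl_max x y : (y <= pcompl x) = (x `&` y == \bot).
Proof.
apply/idP/eqP => [yx|xy]; last exact: Sup_ub.
apply/eqP; rewrite -lex0; apply: le_trans (leI2 (lexx x) yx) _.
by rewrite meetSup; apply: Sup_le => _ [z /= + <-] => ->.
Qed.

Lemma meet_pcompl x : x `&` pcompl x = \bot.
Proof. by apply/eqP; rewrite -pcompl_max. Qed.

Lemma pcompl_anti x y : x <= y -> pcompl y <= pcompl x.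
Proof.
move=> xy; rewrite pcompl_max -lex0 -(meet_pcompl y).
exact: leI2 xy (lexx _).
Qed.

Lemma completely_below_le x y : completely_below x y -> x <= y.
Proof.
move=> [c [<- <- /(_ 0 1)%R]] => /(_ isT isT isT) E.
by apply/meet_idPl; rewrite -[RHS]meetx1 -E meetUr meet_pcompl join0x.
Qed.

Lemma completely_below_trans x' x y y' :
  x' <= x -> completely_below x y -> y <= y' -> completely_below x' y'.
Proof.
move=> xx [c [c0 c1 cc]] yy.
exists (fun q => if q == 0%R then x' else if q == 1%R then y' else c q).
split=> // p q p0 pq q1.
have q0 : (q == 0%R) = false by apply/gt_eqF/(le_lt_trans p0 pq).
have p1 : (p == 1%R) = false by apply/lt_eqF/(lt_le_trans pq q1).
rewrite q0 p1; apply/eqP; rewrite -le1x -(cc _ _ p0 pq q1); apply: leU2.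
  by apply: pcompl_anti; case: eqP => // ->; rewrite c0.
by case: eqP => // ->; rewrite c1.
Qed.

Lemma completely_below_top x : completely_below x \top.
Proof.
apply: (@completely_below_trans _ \top \top) => //.
by exists (fun _ => \top); split=> // *; rewrite joinx1.
Qed.

Lemma completely_below_bot x : completely_below \bot x.
Proof.
apply: (@completely_below_trans _ \bot \bot) => //.
exists (fun _ => \bot); split=> // *; apply/eqP; rewrite joinx0 -le1x.
by rewrite pcompl_max meet0x.
Qed.

Lemma completely_belowU x y x' y' : completely_below x y ->
  completely_below x' y' -> completely_below (x `|` x') (y `|` y').
Proof.
move=> [c [<- <- cP]] [c' [<- <- c'P]].
exists (fun q => c q `|` c' q); split=> // p q p0 pq q1.
apply/eqP; rewrite -le1x.
have le_pc : pcompl (c p) `&` pcompl (c' p) <= pcompl (c p `|` c' p).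
  rewrite pcompl_max meetUl meetA meet_pcompl meet0x join0x.
  by rewrite meetCA meet_pcompl meetx0.
apply: le_trans (leU2 le_pc (lexx _)).
rewrite joinIl lexI joinA cP// join1x lexx /=.
by rewrite joinCA c'P// joinx1.
Qed.

Lemma completely_belowI x y x' y' : completely_below x y ->
  completely_below x' y' -> completely_below (x `&` x') (y `&` y').
Proof.
move=> [c [<- <- cP]] [c' [<- <- c'P]].
exists (fun q => c q `&` c' q); split=> // p q p0 pq q1.
apply/eqP; rewrite -le1x joinIr lexI -{1}(cP _ _ p0 pq q1).
rewrite -(c'P _ _ p0 pq q1).
by rewrite !leU2// pcompl_anti// ?leIl ?leIr.
Qed.

Lemma Coz_top : Coz (\top : L).
Proof.
exists (fun=> \top) => [n|]; first exact: completely_below_top.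
by apply/esym/eqP; rewrite -le1x; apply: Sup_ub; exists 0%N.
Qed.

Lemma Coz_meet x y : Coz x -> Coz y -> Coz (x `&` y).
Proof.
move=> [a aP ->] [b bP ->].
exists (fun n => a n `&` b n) => [n|]; first exact: completely_belowI.
have mono (u : nat -> L) : (forall n, completely_below (u n) (u n.+1)) ->
    {homo u : m n / (m <= n)%N >-> m <= n}.
  move=> uP; apply: (@homo_leq _ u (fun x y => x <= y)) => //.
    by move=> ? ? ?; apply: le_trans.
  by move=> n; exact: completely_below_le.
apply/le_anti/andP; split; last first.
  apply: Sup_le => _ [n _ <-].
  by apply: leI2; apply: Sup_ub; exists n.
rewrite meetSup; apply: Sup_le => _ [_ [m _ <-] <-].
rewrite meetC meetSup; apply: Sup_le => _ [_ [n _ <-] <-].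
apply: (@le_trans _ _ (a (maxn m n) `&` b (maxn m n))); last first.
  by apply: Sup_ub; exists (maxn m n).
rewrite meetC; apply: leI2.
  by apply: mono => //; exact: leq_maxr.
by apply: mono => //; exact: leq_maxl.
Qed.

Lemma Coz_bot : Coz (\bot : L).
Proof.
exists (fun=> \bot) => [n|]; first exact: completely_below_bot.
by apply/esym/eqP; rewrite -lex0; apply: Sup_le => _ [n _ <-].
Qed.

Lemma Coz_Sup A : countable A -> A `<=` @Coz d L -> Coz (Sup A).
Proof.
move=> Ac AC; have [A0|/set0P[x0 Ax0]] := eqVneq A set0.
  suff -> : Sup A = \bot by exact: Coz_bot.
  by apply/eqP; rewrite -lex0; apply: Sup_le; rewrite A0.
have /countable_injP[f finj] := Ac.
pose Q n (a : nat -> L) := (forall k, completely_below (a k) (a k.+1)) /\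
  A (Sup (range a)) /\ forall x, A x -> f x = n -> x = Sup (range a).
have QP n : exists a, Q n a.
  have [[x [Ax fx]]|nx] := pselect (exists x, A x /\ f x = n).
    have [a aP xa] := AC _ Ax; exists a; split=> //; rewrite -xa.
    by split=> // y Ay fy; apply: finj; rewrite ?inE// fx.
  have [a aP xa] := AC _ Ax0; exists a; split=> //; rewrite -xa.
  by split=> // y Ay fy; exfalso; apply: nx; exists y.
have [a aP] := boolp.choice QP.
exists (fun n => \join_(i < n.+1) a i n) => [n|].
  suff: completely_below (\join_(i < n.+1) a i n) (\join_(i < n.+1) a i n.+1).
    move/(completely_below_trans (lexx _)); apply.
    by rewrite [leRHS]big_ord_recr /= leUl.
  elim/big_ind2: _ => [|x1 x2 y1 y2|i _]; first exact: completely_below_bot.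
    exact: completely_belowU.
  by have [] := aP i.
apply/le_anti/andP; split.
  apply: Sup_le => x Ax; have [aP1 [_ aP2]] := aP (f x).
  rewrite (aP2 x Ax erefl); apply: Sup_le => _ [k _ <-].
  pose m := maxn (f x) k.
  have am : a (f x) k <= a (f x) m.
    apply: (@homo_leq _ (a (f x)) (fun x y => x <= y)) => //.
    - by move=> ? ? ?; apply: le_trans.
    - by move=> i; exact: completely_below_le.
    - exact: leq_maxr.
  apply: (le_trans am).
  apply: (@le_trans _ _ (\join_(i < m.+1) a i m)); last first.
    by apply: Sup_ub; exists m.
  have fm : (f x < m.+1)%N by rewrite ltnS leq_maxl.
  exact: (@joins_sup _ _ _ (Ordinal fm) xpredT (fun i => a (nat_of_ord i) m)).
apply: Sup_le => _ [n _ <-]; apply/joinsP => i _.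
have [_ [Aa _]] := aP i.
by apply: le_trans (Sup_ub Aa); apply: Sup_ub; exists n.
Qed.

End FrameFacts.

Section Lindelof.
Context d (L : frameType d).

Definition lindelof := subposet (@sigma_ideal d L).

HB.instance Definition _ := Order.SubPOrder.on lindelof.

Implicit Types (I J K : lindelof) (F : set lindelof).

Fact lindelofP I : sigma_ideal (val I).
Proof. exact: subposetP. Qed.

Fact lindelof_leP I J : reflect (val I `<=` val J) (I <= J).
Proof. exact: asboolP. Qed.

Fact lindelof_meet_subproof I J : sigma_ideal (val I `&` val J)%classic.
Proof.
have [IC Id Is] := lindelofP I; have [JC Jd Js] := lindelofP J.
split=> [x [/IC]//|x y yC yx [Ix Jx]|A Ac AIJ].
  by split; [exact: Id Ix|exact: Jd Jx].
by split; [apply: Is|apply: Js] => // x /AIJ[].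
Qed.

Definition lindelof_meet I J : lindelof :=
  in_subposet (lindelof_meet_subproof I J).

Fact lindelof_top_subproof : sigma_ideal (@Coz d L).
Proof. by split=> // A; exact: Coz_Sup. Qed.

Definition lindelof_top : lindelof := in_subposet lindelof_top_subproof.

Fact lindelof_Sup_subproof F :
  sigma_ideal (smallest (@sigma_ideal d L) (\bigcup_(I in F) val I)).
Proof.
split.
- apply: smallest_sub; first exact: lindelof_top_subproof.
  by move=> x [I _ Ix]; have [+ _ _] := lindelofP I; apply.
- move=> x y yC yx Fx J [Js FJ]; have [_ Jd _] := Js.
  by apply: Jd (Fx _ _).
- move=> A Ac AF J [Js FJ]; have [_ _] := Js; apply=> // x /AF; exact.
Qed.

Definition lindelof_Sup F : lindelof := in_subposet (lindelof_Sup_subproof F).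

Fact lindelof_meetP K I J : (K <= lindelof_meet I J) = (K <= I) && (K <= J).
Proof.
apply/lindelof_leP/andP => [KIJ|[/lindelof_leP KI /lindelof_leP KJ]].
  by split; apply/lindelof_leP => x /KIJ[].
by move=> x Kx; split; [exact: KI|exact: KJ].
Qed.

Fact lindelof_topP I : I <= lindelof_top.
Proof. by apply/lindelof_leP; have [] := lindelofP I. Qed.

Fact lindelof_SupP F : isLub F (lindelof_Sup F).
Proof.
split=> [I FI|J FJ]; apply/lindelof_leP.
  by move=> x Ix; apply: sub_gen_smallest; exists I.
by apply: smallest_sub; [exact: lindelofP|move=> x [I /FJ/lindelof_leP IJ]; exact: IJ].
Qed.

Fact lindelof_meetSup I F :
  lindelof_meet I (lindelof_Sup F) <=
    lindelof_Sup [set lindelof_meet I J | J in F].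
Proof.
set K := lindelof_Sup [set _ | _ in _].
have [KC Kd Ks] := lindelofP K; have [IC Id _] := lindelofP I.
apply/lindelof_leP => x [Ix Fx].
suff [_ /(_ x Ix)] : Coz x /\ forall z, val I z -> val K (z `&` x).
  by rewrite meetxx.
apply: (Fx [set y | Coz y /\ forall z, val I z -> val K (z `&` y)]).
split=> [|y [J FJ Jy]]; last first.
  have [JC Jd _] := lindelofP J; split=> [|z Iz]; first exact: JC.
  have zyC : Coz (z `&` y) by apply: Coz_meet; [exact: IC|exact: JC].
  apply: sub_gen_smallest; exists (lindelof_meet I J); first by exists J.
  by split; [apply: (Id z)|apply: (Jd y)]; rewrite ?leIl ?leIr.
split=> [y []//|y z zC zy [yC IKy]|A Ac AI].
  split=> // t It; apply: Kd (IKy t It); last exact: leI2.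
  by apply: Coz_meet => //; exact: IC.
split=> [|t It]; first by apply: Coz_Sup => // y /AI[].
rewrite meetSup; apply: Ks; first exact: sub_countable (card_image_le _ _) Ac.
by move=> _ [y /AI[_ yK] <-]; exact: yK.
Qed.

HB.instance Definition _ := POrder_isFrame.Build set_display lindelof
  lindelof_meetP lindelof_topP lindelof_SupP lindelof_meetSup.

End Lindelof.

Section StoneCech.
Context d (L : frameType d).

Definition stone_cech := subposet (@regular_ideal d L).

HB.instance Definition _ := Order.SubPOrder.on stone_cech.

Implicit Types (I J K : stone_cech) (F : set stone_cech).

Fact stone_cechP I : regular_ideal (val I).
Proof. exact: subposetP. Qed.

Fact stone_cech_leP I J : reflect (val I `<=` val J) (I <= J).
Proof. exact: asboolP. Qed.

Fact stone_cech_meet_subproof I J : regular_ideal (val I `&` val J)%classic.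
Proof.
have [[I0 Id IU] Ir] := stone_cechP I; have [[J0 Jd JU] Jr] := stone_cechP J.
split=> [|x [/Ir[y Iy xy] /Jr[z Jz xz]]].
  split=> // [x y yx [Ix Jx]|x y [Ix Jx] [Iy Jy]].
    by split; [exact: Id Ix|exact: Jd Jx].
  by split; [exact: IU|exact: JU].
exists (y `&` z); last by rewrite -[x]meetxx; exact: completely_belowI.
by split; [apply: (Id y)|apply: (Jd z)]; rewrite ?leIl ?leIr.
Qed.

Definition stone_cech_meet I J : stone_cech :=
  in_subposet (stone_cech_meet_subproof I J).

Fact stone_cech_top_subproof : regular_ideal [set: L].
Proof. by split=> // x _; exists \top => //; exact: completely_below_top. Qed.

Definition stone_cech_top : stone_cech := in_subposet stone_cech_top_subproof.

(* Joins are ideal joins: elements below a finite join from the union. *)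
Definition stone_cech_Sup_set F : set L :=
  [set x | exists2 s : seq L,
     forall y, y \in s -> (\bigcup_(I in F) val I) y & x <= \join_(y <- s) y].

Fact stone_cech_Sup_subproof F : regular_ideal (stone_cech_Sup_set F).
Proof.
split=> [|x [s sF xs]].
  split=> [|x y yx [s sF xs]|x y [s sF xs] [t tF yt]].
  - by exists [::].
  - by exists s => //; exact: le_trans xs.
  - exists (s ++ t) => [z|]; first by rewrite mem_cat => /orP[/sF|/tF].
    by rewrite big_cat; exact: leU2.
suff [t tF st] : exists2 t : seq L,
    forall y, y \in t -> (\bigcup_(I in F) val I) y &
    completely_below (\join_(y <- s) y) (\join_(y <- t) y).
  exists (\join_(y <- t) y); first by exists t.
  exact: completely_below_trans xs st (lexx _).
elim: s sF {xs} => [_|y s IHs sF].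
  by exists [::] => //; rewrite !big_nil; exact: completely_below_bot.
have [z zs|t tF st] := IHs; first by apply: sF; rewrite inE zs orbT.
have [I FI Iy] := sF y (mem_head _ _).
have [_ /(_ y Iy)[z Iz yz]] := stone_cechP I.
exists (z :: t) => [w|]; last by rewrite !big_cons; exact: completely_belowU.
by rewrite inE => /orP[/eqP ->|/tF//]; exists I.
Qed.

Definition stone_cech_Sup F : stone_cech :=
  in_subposet (stone_cech_Sup_subproof F).

Fact stone_cech_meetP K I J :
  (K <= stone_cech_meet I J) = (K <= I) && (K <= J).
Proof.
apply/stone_cech_leP/andP => [KIJ|[/stone_cech_leP KI /stone_cech_leP KJ]].
  by split; apply/stone_cech_leP => x /KIJ[].
by move=> x Kx; split; [exact: KI|exact: KJ].
Qed.

Fact stone_cech_topP I : I <= stone_cech_top.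
Proof. exact/stone_cech_leP. Qed.

Fact stone_cech_SupP F : isLub F (stone_cech_Sup F).
Proof.
split=> [I FI|J FJ]; apply/stone_cech_leP.
  move=> x Ix; exists [:: x]; last by rewrite big_seq1.
  by move=> y; rewrite inE => /eqP ->; exists I.
have [[J0 Jd JU] _] := stone_cechP J.
move=> x [s sF xs]; apply: Jd xs _; elim: s sF => [_|y s IHs sF].
  by rewrite big_nil.
rewrite big_cons; apply: JU.
  by have [I /FJ/stone_cech_leP IJ] := sF y (mem_head _ _); exact: IJ.
by apply: IHs => z zs; apply: sF; rewrite inE zs orbT.
Qed.

Fact stone_cech_meetSup I F :
  stone_cech_meet I (stone_cech_Sup F) <=
    stone_cech_Sup [set stone_cech_meet I J | J in F].
Proof.
have [[_ Id _] _] := stone_cechP I.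
apply/stone_cech_leP => x [Ix [s sF xs]].
exists [seq x `&` y | y <- s].
  move=> _ /mapP[y /sF[J FJ Jy] ->].
  have [[_ Jd _] _] := stone_cechP J.
  exists (stone_cech_meet I J); first by exists J.
  by split; [apply: (Id x)|apply: (Jd y)]; rewrite ?leIl ?leIr.
rewrite big_map; have -> : \join_(y <- s) (x `&` y) = x `&` \join_(y <- s) y.
  elim: s {sF xs} => [|y s IHs]; first by rewrite !big_nil meetx0.
  by rewrite !big_cons IHs meetUr.
by rewrite lexI lexx.
Qed.

HB.instance Definition _ := POrder_isFrame.Build set_display stone_cech
  stone_cech_meetP stone_cech_topP stone_cech_SupP stone_cech_meetSup.

End StoneCech.

Section DInfinity.
Context d (A : meetSemilatticeType d).
Implicit Types (a x y : A) (G E : set A).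

Definition admissible G := exists2 s, isLub G s &
  forall a, isLub [set a `&` y | y in G] (a `&` s).

Definition D_ideal E :=
  (forall x y, y <= x -> E x -> E y) /\
  (forall G s, admissible G -> G `<=` E -> isLub G s -> E s).

Definition D_infinity := subposet D_ideal.

HB.instance Definition _ := Order.SubPOrder.on D_infinity.

Implicit Types (I J K : D_infinity) (F : set D_infinity).

Fact isLub_unique G x y : isLub G x -> isLub G y -> x = y.
Proof.
by move=> [ux lx] [uy ly]; apply/le_anti; rewrite lx//= ly.
Qed.

Fact D_infinityP I : D_ideal (val I).
Proof. exact: subposetP. Qed.

Fact D_infinity_leP I J : reflect (val I `<=` val J) (I <= J).
Proof. exact: asboolP. Qed.

Fact principal_subproof a : D_ideal [set x | x <= a].
Proof.
split=> [x y yx xa|G s _ Ga [_ lub]]; first exact: le_trans xa.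
exact: lub.
Qed.

Definition principal a : D_infinity := in_subposet (principal_subproof a).

Fact D_infinity_meet_subproof I J : D_ideal (val I `&` val J)%classic.
Proof.
have [Id Is] := D_infinityP I; have [Jd Js] := D_infinityP J.
split=> [x y yx [Ix Jx]|G s Ga GIJ Gs].
  by split; [exact: Id Ix|exact: Jd Jx].
by split; [apply: (Is G)|apply: (Js G)] => // x /GIJ[].
Qed.

Definition D_infinity_meet I J : D_infinity :=
  in_subposet (D_infinity_meet_subproof I J).

Fact D_infinity_top_subproof : D_ideal [set: A].
Proof. by []. Qed.

Definition D_infinity_top : D_infinity := in_subposet D_infinity_top_subproof.

Fact D_infinity_Sup_subproof F :
  D_ideal (smallest D_ideal (\bigcup_(I in F) val I)).
Proof.
split=> [x y yx Fx J|G s Ga GF Gs J] [Js FJ]; have [Jd Jc] := Js.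
  by apply: Jd yx (Fx _ _).
by apply: (Jc G) => // x /GF; exact.
Qed.

Definition D_infinity_Sup F : D_infinity :=
  in_subposet (D_infinity_Sup_subproof F).

Fact D_infinity_meetP K I J :
  (K <= D_infinity_meet I J) = (K <= I) && (K <= J).
Proof.
apply/D_infinity_leP/andP => [KIJ|[/D_infinity_leP KI /D_infinity_leP KJ]].
  by split; apply/D_infinity_leP => x /KIJ[].
by move=> x Kx; split; [exact: KI|exact: KJ].
Qed.

Fact D_infinity_topP I : I <= D_infinity_top.
Proof. exact/D_infinity_leP. Qed.

Fact D_infinity_SupP F : isLub F (D_infinity_Sup F).
Proof.
split=> [I FI|J FJ]; apply/D_infinity_leP.
  by move=> x Ix; apply: sub_gen_smallest; exists I.
apply: smallest_sub; first exact: D_infinityP.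
by move=> x [I /FJ/D_infinity_leP IJ]; exact: IJ.
Qed.

Fact D_infinity_meetSup I F :
  D_infinity_meet I (D_infinity_Sup F) <=
    D_infinity_Sup [set D_infinity_meet I J | J in F].
Proof.
set K := D_infinity_Sup [set _ | _ in _].
have [Kd Ks] := D_infinityP K; have [Id _] := D_infinityP I.
apply/D_infinity_leP => x [Ix Fx].
suff /(_ x Ix) : forall z, val I z -> val K (z `&` x) by rewrite meetxx.
apply: (Fx [set y | forall z, val I z -> val K (z `&` y)]).
split=> [|y [J FJ Jy] z Iz]; last first.
  have [Jd _] := D_infinityP J.
  apply: sub_gen_smallest; exists (D_infinity_meet I J); first by exists J.
  by split; [apply: (Id z)|apply: (Jd y)]; rewrite ?leIl ?leIr.
split=> [y z zy IKy t It|G s [s' Gs' Gm] GI Gs t It].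
  by apply: Kd (IKy t It); exact: leI2.
rewrite -{s Gs}(isLub_unique Gs' Gs).
apply: (Ks [set t `&` y | y in G]) => [|_ [y Gy <-]|]; [|exact: GI|exact: Gm].
exists (t `&` s') => // a.
rewrite (_ : [set a `&` y | y in _] = [set (a `&` t) `&` y | y in G]).
  by rewrite meetA; exact: Gm.
apply/seteqP; split=> [_ [_ [y Gy <-] <-]|_ [y Gy <-]].
  by exists y; rewrite ?meetA.
by exists (t `&` y); [exists y|rewrite meetA].
Qed.

HB.instance Definition _ := POrder_isFrame.Build set_display D_infinity
  D_infinity_meetP D_infinity_topP D_infinity_SupP D_infinity_meetSup.

End DInfinity.

Section ComplementedElements.
Context d (L : frameType d).

Fact complementedI :
  {in @complemented d L &, forall x y, x `&` y \in @complemented d L}.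
Proof.
move=> x y; rewrite !inE => -[x' xI xU] [y' yI yU]; exists (x' `|` y').
  rewrite meetUr [x `&` y `&` x']meetAC xI meet0x join0x -meetA yI.
  by rewrite meetx0.
by rewrite joinIl joinA xU join1x meet1x joinCA yU joinx1.
Qed.

Fact complementedU :
  {in @complemented d L &, forall x y, x `|` y \in @complemented d L}.
Proof.
move=> x y; rewrite !inE => -[x' xI xU] [y' yI yU]; exists (x' `&` y').
  by rewrite meetUl meetA xI meet0x join0x meetCA yI meetx0.
rewrite joinIr [x `|` y `|` x']joinAC xU join1x meet1x -joinA yU.
by rewrite joinx1.
Qed.

Fact complemented0 : \bot \in (@complemented d L).
Proof. by rewrite inE; exists \top; rewrite ?meet0x ?joinx1. Qed.

Fact complemented1 : \top \in (@complemented d L).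
Proof. by rewrite inE; exists \bot; rewrite ?meetx0 ?join1x. Qed.

Definition CL := {x : L | x \in @complemented d L}.

HB.instance Definition _ := SubChoice.on CL.
HB.instance Definition _ :=
  Order.SubChoice_isTBSubLattice.Build d L _ d CL
    complementedI complementedU complemented0 complemented1.

Definition D_sigma_CL : set (D_infinity CL) :=
  smallest (@sub_sigma_frame _ (D_infinity CL))
    (range (@principal _ CL)).

Definition CL_coole := D_sigma_CL = [set: D_infinity CL].

End ComplementedElements.

(* Main.v *)
From HB Require Import structures.
Require Import Defs.
From mathcomp Require Import all_boot all_order all_algebra.
From mathcomp Require Import boolp classical_sets functions cardinality.

Set Implicit Arguments.
Unset Strict Implicit.
Unset Printing Implicit Defensive.

Import Order.TTheory.
Local Open Scope classical_set_scope.
Local Open Scope order_scope.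

(** For a strongly zero-dimensional [L], being coole, for [L] and for its
    two coreflections, and being [CL]-coole all say the same thing about the
    Boolean algebra [CL]: every subset of [CL] has the same upper bounds as
    some countable subset ([countably_bounded]).

    In a zero-dimensional frame a regular element is determined by its
    complemented upper bounds, and [(Sup A)^**] has the same complemented
    upper bounds as [A]. Strong zero-dimensionality makes the cozero
    elements the countable joins of complemented ones, so being coole says
    that each subset of [CL] can be replaced by a countable one with the
    same upper bounds ([coole_countably_bounded]). In a Boolean algebra
    every existing join is admissible, so that a D-ideal is the set of lower
    bounds of its upper bounds; the D-ideals in the sigma-frame generated by
    the principal ones are those with a countable set of elements having the
    same upper bounds ([D_sigma_countably_bounded]).

    Since [countably_bounded] is invariant under isomorphism, the
    coreflections [lambda L] and [beta L] are coole exactly when [L] is,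
    once they are known to be strongly zero-dimensional with the same
    Boolean algebra of complemented elements as [L]. Both facts come from
    one criterion ([base_coole]): it is enough that [CL] embeds into the
    frame as a base of complemented elements, and that some member of the
    base lies between [I] and [J] whenever [I] is rather below [J], that is
    [I^* \/ J = \top]. Applied to [I = J] complemented, the last property
    makes the embedding onto; applied along a cozero sequence, it writes a
    cozero element as a countable join of the base. For the two
    coreflections it comes from separating two cozero elements that cover
    the top by a complemented element ([Coz_separation]).

    The poset of regularized cozero elements is handled directly: if [L] is
    coole then it is the Booleanization, which is a frame; conversely [CL]
    is both join-dense and meet-dense in the Booleanization, so that any
    complete poset between the two is the whole Booleanization. *)

(** * Upper bounds of countable subsets *)

Section CountablyBounded.

Definition countably_bounded d (T : porderType d) :=
  forall A : set T, exists2 G, countable G & ubound A = ubound G.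

Lemma countable_image T U (f : T -> U) (A : set T) :
  countable A -> countable (f @` A).
Proof. exact/sub_countable/card_image_le. Qed.

Lemma countably_bounded_iso d d' (T : porderType d) (U : porderType d')
    (f : T -> U) :
  {mono f : x y / x <= y} -> (forall u, exists x, f x = u) ->
  countably_bounded T <-> countably_bounded U.
Proof.
move=> fmono fsurj.
suff tr d1 d2 (T1 : porderType d1) (T2 : porderType d2) (g : T1 -> T2) :
    {mono g : x y / x <= y} -> (forall u, exists x, g x = u) ->
    countably_bounded T1 -> countably_bounded T2.
  split; first exact: tr fmono fsurj.
  have [g gK] := boolp.choice fsurj.
  apply: (tr _ _ _ _ g) => [x y|x]; first by rewrite -fmono !gK.
  by exists (f x); apply: (inc_inj fmono); rewrite gK.
move=> gmono gsurj T1b A.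
have [G Gc GE] := T1b (g @^-1` A).
exists (g @` G); first exact: countable_image.
apply/seteqP; split=> u.
  have [x <-] := gsurj u => Ax _ [y Gy <-]; rewrite gmono.
  suff: ubound G x by apply.
  by rewrite -GE => z /= /Ax; rewrite gmono.
have [x <-] := gsurj u => Gx v; have [y <-] := gsurj v => Ay; rewrite gmono.
suff: ubound (g @^-1` A) x by apply.
by rewrite GE => z Gz; rewrite -gmono; apply: Gx; exists z.
Qed.

End CountablyBounded.

(** Complements give residuals; this replaces Boolean negation in lattices
    that are only assumed to have complements. *)
Lemma meet_le_compl d (T : tbDistrLatticeType d) (a a' x b : T) :
  a `&` a' = \bot -> a `|` a' = \top -> (a `&` x <= b) = (x <= a' `|` b).
Proof.
move=> aI aU; apply/idP/idP => [axb|xab].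
  rewrite -[x]meet1x -aU meetUl joinC; apply: leU2 => //; exact: leIl.
apply: le_trans (leI2 (lexx a) xab) _.
by rewrite meetUr aI join0x leIr.
Qed.

(** * D-ideals of a Boolean algebra *)

Section BooleanIdeals.
Context d (T : tbDistrLatticeType d).
Hypothesis compl : forall x : T, exists2 y, x `&` y = \bot & x `|` y = \top.
Implicit Types (E F : D_infinity T) (a b : T) (G : set T).

(** Meeting with [a] has a right adjoint, hence preserves existing joins: in a
    Boolean algebra every set with a join is admissible. *)
Lemma isLub_meet a G s :
  isLub G s -> isLub [set a `&` y | y in G] (a `&` s).
Proof.
move=> [ub lub]; split=> [_ [y Gy <-]|b ab]; first by rewrite leI2// ub.
have [a' aI aU] := compl a.
rewrite (meet_le_compl _ _ aI aU); apply: lub => y Gy.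
by rewrite -(meet_le_compl _ _ aI aU); apply: ab; exists y.
Qed.

(** D-ideals are normal: if [a] is below all upper bounds of [E] then [a] is
    the join of the elements [a `&` y] with [y] in [E], and this join is
    admissible. *)
Lemma D_ideal_ubound E a : (forall b, ubound (val E) b -> a <= b) -> val E a.
Proof.
move=> aE; have [Ed Es] := D_infinityP E.
have aG : isLub [set a `&` y | y in val E] a.
  split=> [_ [y _ <-]|b ab]; first exact: leIl.
  have [a' aI aU] := compl a.
  rewrite -[a]meetxx (meet_le_compl _ _ aI aU); apply: aE => y Ey.
  by rewrite -(meet_le_compl _ _ aI aU); apply: ab; exists y.
apply: (Es _ _ _ _ aG) => [|_ [y Ey <-]]; last exact: Ed (leIr _ _) Ey.
by exists a => // t; exact: isLub_meet.
Qed.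

Lemma D_infinity_le E F :
  (forall b, ubound (val F) b -> ubound (val E) b) -> E <= F.
Proof.
move=> FE; apply/D_infinity_leP => x Ex.
by apply: D_ideal_ubound => b /FE; apply.
Qed.

Lemma ubound_Sup (D : set (D_infinity T)) b :
  ubound (val (Sup D)) b <-> forall E, D E -> ubound (val E) b.
Proof.
split=> [Db E DE x Ex|Db x].
  by apply: Db; move/D_infinity_leP: (Sup_ub DE); apply.
have /D_infinity_leP : Sup D <= principal b; last exact.
by apply: Sup_le => E DE; apply/D_infinity_leP => y; apply: Db.
Qed.

Lemma ubound_principal a b : ubound (val (principal a)) b <-> a <= b.
Proof. by split=> [|ab x xa]; [apply=> /=|exact: le_trans ab]. Qed.

(** Countable sets with the right upper bounds can be met elementwise, so the
    D-ideals that have one are closed under binary meets. *)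
Lemma ubound_meet E F G H :
  ubound (val E) = ubound G -> ubound (val F) = ubound H ->
  ubound (val (E `&` F)) = ubound [set xy.1 `&` xy.2 | xy in G `*` H].
Proof.
move=> EG FH.
have EFE : val (E `&` F) = (val E `&` val F)%classic by [].
have GE : G `<=` val E.
  by move=> x Gx; apply: D_ideal_ubound => b; rewrite EG; apply.
have HF : H `<=` val F.
  by move=> x Hx; apply: D_ideal_ubound => b; rewrite FH; apply.
have [[Ed _] [Fd _]] := (D_infinityP E, D_infinityP F).
apply/seteqP; split=> b; rewrite EFE.
  move=> EFb _ [[x y] /= [/GE Ex /HF Fy] <-]; apply: EFb.
  by split; [apply: Ed Ex; exact: leIl|apply: Fd Fy; exact: leIr].
move=> GHb x [Ex Fx].
have [x' xI xU] := compl x.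
rewrite -[x]meetxx (meet_le_compl _ _ xI xU).
suff: ubound (val E) (x' `|` b) by apply.
rewrite EG => g Gg; rewrite -(meet_le_compl _ _ xI xU) meetC.
have [g' gI gU] := compl g.
rewrite (meet_le_compl _ _ gI gU).
suff: ubound (val F) (g' `|` b) by apply.
rewrite FH => h Hh; rewrite -(meet_le_compl _ _ gI gU).
by apply: GHb; exists (g, h).
Qed.

(** The D-ideals with the same upper bounds as a countable set form a
    sub-sigma-frame containing the principal ideals, and each of them is the
    join of countably many principal ideals; so they are exactly the generated
    sub-sigma-frame. *)
Lemma D_sigma_countably_bounded :
  smallest (@sub_sigma_frame _ (D_infinity T)) (range (@principal _ T)) = setT
  <-> countably_bounded T.
Proof.
split=> [DT A|Tb]; last first.
  apply/seteqP; split=> // E _ S [[_ _ Ss] Sp].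
  have [G Gc GE] := Tb (val E).
  suff -> : E = Sup [set principal a | a in G].
    by apply: Ss => [|_ [a _ <-]]; [exact: countable_image|apply: Sp; exists a].
  suff EG b : ubound (val E) b <->
      ubound (val (Sup [set principal a | a in G])) b.
    by apply/le_anti/andP; split; apply: D_infinity_le => b /EG.
  rewrite GE ubound_Sup; split=> [Gb _ [a Ga <-]|Gb a Ga].
    exact/ubound_principal/Gb.
  by apply/ubound_principal/Gb; exists a.
pose Q := [set E : D_infinity T |
  exists2 G, countable G & ubound (val E) = ubound G].
suff QT E : Q E.
  have [G Gc GE] := QT (Sup [set principal a | a in A]).
  exists G => //; rewrite -GE; apply/seteqP; split=> b.
    by move=> Ab; apply/ubound_Sup => _ [a Aa <-]; exact/ubound_principal/Ab.
  by move=> /ubound_Sup Ab a Aa; apply/ubound_principal/Ab; exists a.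
have : [set: D_infinity T] E by [].
rewrite -DT; apply; split; last first.
  by move=> _ [a _ <-]; exists [set a] => //; apply/seteqP; split=> b;
    rewrite ub_set1 => /ubound_principal.
split.
- exists [set \top] => //; apply/seteqP; split=> b; rewrite ub_set1.
    by apply; have /D_infinity_leP := lex1 (principal (\top : T)); apply => /=.
  by move=> b1 x _; exact: le_trans b1.
- move=> E1 E2 [G1 G1c G1E] [G2 G2c G2E].
  exists [set xy.1 `&` xy.2 | xy in G1 `*` G2]; last exact: ubound_meet.
  exact/countable_image/countableX.
- move=> D Dc DQ.
  have /boolp.choice[g gP] F : exists G, D F ->
      countable G /\ ubound (val F) = ubound G.
    have [/DQ[G Gc GE]|nDF] := pselect (D F); first by exists G.
    by exists set0.
  exists (\bigcup_(F in D) g F).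
    by apply: bigcup_countable => // F /gP[].
  apply/seteqP; split=> b.
    move=> /ubound_Sup Db x [F DF gx].
    by have := Db F DF; rewrite (gP F DF).2; apply.
  move=> gb; apply/ubound_Sup => F DF; rewrite (gP F DF).2 => x gx.
  by apply: gb; exists F.
Qed.

End BooleanIdeals.

(** * Complemented upper bounds of regular elements *)

Section Regular.
Context d (L : frameType d).
Implicit Types (x y z c : L) (A : set L).

Lemma le_pcomplK x : x <= pcompl (pcompl x).
Proof. by rewrite pcompl_max meetC meet_pcompl. Qed.

Lemma pcompl3 x : pcompl (pcompl (pcompl x)) = pcompl x.
Proof. by apply/le_anti; rewrite le_pcomplK andbT pcompl_anti// le_pcomplK. Qed.

Lemma complemented_pcompl c :
  complemented c -> [/\ complemented (pcompl c), c `|` pcompl c = \top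
    & pcompl (pcompl c) = c].
Proof.
move=> [c' cI cU].
have -> : pcompl c = c'.
  apply/le_anti; rewrite pcompl_max cI eqxx andbT.
  rewrite -[pcompl c]meet1x -cU meetUl meet_pcompl join0x; exact: leIl.
split=> //; first by exists c; rewrite 1?meetC 1?joinC.
apply/le_anti; rewrite pcompl_max meetC cI eqxx andbT.
rewrite -[pcompl c']meet1x -cU joinC meetUl meet_pcompl join0x; exact: leIl.
Qed.

Lemma pcomplK_le_complemented x c :
  complemented c -> (pcompl (pcompl x) <= c) = (x <= c).
Proof.
move=> /complemented_pcompl[_ _ cK]; apply/idP/idP.
  exact: le_trans (le_pcomplK x).
by rewrite -[in X in _ -> X]cK => xc; do 2!apply: pcompl_anti.
Qed.

(** If [a] is a complemented element below [x^*], then [a^*] is an upper bound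
    of [x]; zero-dimensionality turns these into enough upper bounds, since
    [x^*] is a join of such [a]. *)
Lemma regular_le x y : zero_dimensional L -> booleanization x ->
  (forall c, complemented c -> x <= c -> y <= c) -> y <= x.
Proof.
move=> Lz -> xy; have [A AC xA] := Lz (pcompl x).
rewrite pcompl_max meetC {1}xA meetSup -lex0; apply: Sup_le => _ [a Aa <-].
have [aC _ aK] := complemented_pcompl (AC _ Aa).
rewrite lex0 meetC -pcompl_max; apply: xy => //.
by rewrite -pcompl3; apply: pcompl_anti; rewrite pcompl3 xA; exact: Sup_ub.
Qed.

Lemma completely_below_complemented c : complemented c -> completely_below c c.
Proof.
move=> /complemented_pcompl[_ cU _].
by exists (fun=> c); split=> // *; rewrite joinC.
Qed.

Lemma complemented_Coz c : complemented c -> Coz c.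
Proof.
move=> /completely_below_complemented cc.
exists (fun=> c) => //; apply/le_anti; rewrite Sup_ub/=; last by exists 0%N.
by apply: Sup_le => _ [_ _ <-].
Qed.

(** Regular elements correspond to sets of complemented upper bounds of subsets
    of [CL], and those of the form [z^**] with [z] cozero to sets of upper
    bounds of countable subsets. *)
Lemma coole_countably_bounded :
  strongly_zero_dimensional L -> coole L <-> countably_bounded (CL L).
Proof.
move=> [Lz Ls].
have ubE (A : set L) (u : CL L) : A `<=` @complemented _ L ->
    is_true (Sup A <= val u) = ubound [set v : CL L | A (val v)] u.
  move=> AC; apply/propext; split=> [Au v Av|Au].
    by rewrite leEsub; exact: le_trans (Sup_ub Av) Au.
  apply: Sup_le => x Ax; have xC := mem_set (AC _ Ax).
  exact: (Au (exist _ x xC)).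
have CLP (u : CL L) : complemented (val u) by exact: set_mem (valP u).
split=> [Lc A|Lb]; last first.
  apply/seteqP; split=> [_ [x _ <-]|x xB].
    by rewrite /booleanization/= pcompl3.
  have [A AC xA] := Lz x.
  have [G Gc GE] := Lb [set v : CL L | A (val v)].
  have zG (c : CL L) : Sup [set val v | v in G] <= val c <-> x <= val c.
    rewrite xA (ubE A)// GE; split=> [Gx v Gv|Gx].
      by rewrite leEsub; apply: le_trans Gx; apply: Sup_ub; exists v.
    by apply: Sup_le => _ [v Gv <-]; have := Gx v Gv; rewrite leEsub.
  exists (Sup [set val v | v in G]).
    apply: Coz_Sup; first exact: countable_image.
    by move=> _ [v _ <-]; exact: complemented_Coz.
  apply/le_anti/andP; split; apply: regular_le => //.
  - move=> c cC; rewrite pcomplK_le_complemented//.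
    by move/(zG (exist _ c (mem_set cC))).
  - by rewrite /booleanization/= pcompl3.
  - move=> c cC; rewrite pcomplK_le_complemented//.
    by move/(zG (exist _ c (mem_set cC))).
have : booleanization (pcompl (pcompl (Sup [set val v | v in A]))).
  by rewrite /booleanization/= pcompl3.
rewrite -Lc => -[z /Ls[A' [A'c A'C ->]] zE].
exists [set v : CL L | A' (val v)].
  have /countable_injP[f finj] := A'c.
  apply/countable_injP; exists (f \o val) => u v /[!inE] Au Av /finj uv.
  by apply: val_inj; apply: uv; rewrite inE.
apply/seteqP; split=> u; rewrite -ubE//.
  move=> Au; rewrite -pcomplK_le_complemented// zE pcomplK_le_complemented//.
  by apply: Sup_le => _ [v Av <-]; have := Au v Av; rewrite leEsub.
rewrite -pcomplK_le_complemented// zE pcomplK_le_complemented// => Au v Av.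
by rewrite leEsub; apply: le_trans Au; apply: Sup_ub; exists v.
Qed.

Lemma CL_compl (u : CL L) : exists2 v, u `&` v = \bot & u `|` v = \top.
Proof.
have [y yI yU] := set_mem (valP u).
have yC : y \in @complemented d L.
  by rewrite inE; exists (val u); rewrite 1?meetC 1?joinC.
by exists (exist _ y yC); apply: val_inj; rewrite ?SubK.
Qed.

Fact CL_meetUl :
  left_distributive (@Order.meet d (CL L)) (@Order.join d (CL L)).
Proof. by move=> u v w; apply: val_inj; rewrite /= meetUl. Qed.

HB.instance Definition _ :=
  Order.Lattice_Meet_isDistrLattice.Build d (CL L) CL_meetUl.

Lemma CL_coole_countably_bounded : CL_coole L <-> countably_bounded (CL L).
Proof. exact: (D_sigma_countably_bounded (T := CL L) (@CL_compl)). Qed.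

End Regular.

(** * The Booleanization as a frame *)

Section Booleanization.
Context d (L : frameType d).
Implicit Types x y z : L.

Lemma booleanizationP x : booleanization (pcompl (pcompl x)).
Proof. by rewrite /booleanization/= pcompl3. Qed.

Lemma pcomplK_mono x y : x <= y -> pcompl (pcompl x) <= pcompl (pcompl y).
Proof. by move=> xy; do 2!apply: pcompl_anti. Qed.

Lemma booleanizationI x y :
  booleanization x -> booleanization y -> booleanization (x `&` y).
Proof.
move=> xB yB; apply/le_anti; rewrite le_pcomplK lexI {2}xB {3}yB.
by rewrite !pcomplK_mono ?leIl ?leIr.
Qed.

(** Double pseudocomplementation is a nucleus; this inequality is what makes
    finite meets distribute over the regularized joins. *)
Lemma meet_pcomplK_le x y :
  x `&` pcompl (pcompl y) <= pcompl (pcompl (x `&` y)).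
Proof.
rewrite pcompl_max meetA -lex0 -(meet_pcompl (pcompl y)).
apply: leI2 => //.
by rewrite pcompl_max [_ `&` x]meetC meetA [y `&` x]meetC meet_pcompl.
Qed.

Definition regular_poset := subposet (@booleanization d L).

HB.instance Definition _ := Order.SubPOrder.on regular_poset.

Implicit Types (u v w : regular_poset) (A : set regular_poset).

Definition regular_meet u v : regular_poset :=
  in_subposet (booleanizationI (subposetP u) (subposetP v)).

Definition regular_top : regular_poset := in_subposet (booleanizationP \top).

Definition regular_Sup A : regular_poset :=
  in_subposet (booleanizationP (Sup (val @` A))).

Fact regular_meetP w u v : (w <= regular_meet u v) = (w <= u) && (w <= v).
Proof. by rewrite !leEsub SubK lexI. Qed.

Fact regular_topP u : u <= regular_top.
Proof. by rewrite leEsub SubK; apply: le_trans (lex1 _) (le_pcomplK _). Qed.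

Fact regular_SupP A : isLub A (regular_Sup A).
Proof.
split=> [u Au|u uA]; rewrite leEsub SubK.
  by apply: le_trans (le_pcomplK _); apply: Sup_ub; exists u.
rewrite (subposetP u); apply: pcomplK_mono; apply: Sup_le => _ [v Av <-].
by rewrite -leEsub uA.
Qed.

Fact regular_meetSup u A :
  regular_meet u (regular_Sup A) <= regular_Sup [set regular_meet u v | v in A].
Proof.
rewrite leEsub !SubK; apply: le_trans (meet_pcomplK_le _ _) _.
apply: pcomplK_mono; rewrite meetSup; apply: Sup_le => _ [_ [v Av <-] <-].
by apply: Sup_ub; exists (regular_meet u v) => //; exists v.
Qed.

HB.instance Definition _ := POrder_isFrame.Build d regular_poset
  regular_meetP regular_topP regular_SupP regular_meetSup.

Lemma regular_poset_is_frame : poset_is_frame (subposet (@booleanization d L)).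
Proof. exact: (frame_poset_is_frame regular_poset). Qed.

Lemma coole_poset_is_frame :
  coole L -> poset_is_frame (subposet (bool_image (@Coz d L))).
Proof. by move=> ->; exact: regular_poset_is_frame. Qed.

(** Let [s] be the supremum, inside the poset, of
    the complemented elements below a regular [x]. Join-density of [CL] gives
    [x <= s]. Every complemented upper bound of [x] lies in the poset and is
    above [s], so meet-density gives [s <= x]. *)
Lemma poset_is_frame_coole : zero_dimensional L ->
  poset_is_frame (subposet (bool_image (@Coz d L))) -> coole L.
Proof.
move=> Lz [Sc _ _]; apply/seteqP; split=> [_ [x _ <-]|x xB].
  exact: booleanizationP.
have CS c : complemented c -> bool_image (@Coz d L) c.
  move=> cC; exists c; first exact: complemented_Coz.
  by have [] := complemented_pcompl cC.
have [s [sub slub]] := Sc [set u | val u <= x].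
suff -> : x = val s by exact: subposetP.
apply/le_anti/andP; split.
  have [A AC xA] := Lz x; rewrite {1}xA; apply: Sup_le => a Aa.
  have := sub (in_subposet (CS a (AC a Aa))).
  by rewrite leEsub SubK; apply; rewrite /= xA; exact: Sup_ub.
apply: regular_le => // c cC xc.
have := slub (in_subposet (CS c cC)); rewrite leEsub SubK; apply.
by move=> u /= ux; rewrite leEsub SubK; exact: le_trans xc.
Qed.

End Booleanization.

(** * Separation by complemented elements *)

Section Separation.
Context d (L : frameType d).
Implicit Types (x y z a b c : L) (A : set L).

Lemma countable_range A : countable A -> A `<=` @complemented d L ->
  exists2 w : nat -> L, forall n, complemented (w n) & Sup A = Sup (range w).
Proof.
move=> /countable_injP[f finj] AC.
have /boolp.choice[w wP] n : exists y, (A y \/ y = \bot) /\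
    forall x, A x -> f x = n -> x = y.
  have [[x [Ax fx]]|nx] := pselect (exists x, A x /\ f x = n).
    by exists x; split=> [|y Ay fy]; [left|apply: finj; rewrite ?inE ?fx].
  by exists \bot; split=> [|y Ay fy]; [right|exfalso; apply: nx; exists y].
exists w => [n|].
  by have [[/AC//|-> _]] := wP n; exact: set_mem (complemented0 L).
apply/le_anti/andP; split; apply: Sup_le.
  move=> x Ax; have -> := (wP (f x)).2 x Ax erefl.
  by apply: Sup_ub; exists (f x).
move=> _ [n _ <-]; have [[An _|-> _]] := wP n; first exact: Sup_ub.
exact: le0x.
Qed.

(** To bound [x] by [t], parts of [x] covered by complemented elements already
    below [t] may be cut off. *)
Lemma le_meet_pcompl (y : nat -> L) n x t :
  (forall k, (k < n)%N -> complemented (y k) /\ y k <= t) ->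
  x `&` \meet_(k < n) pcompl (y k) <= t -> x <= t.
Proof.
elim: n x => [|n IHn] x yP; first by rewrite big_ord0 meetx1.
rewrite big_ord_recr /= meetA meetAC => xt.
have [yC yt] := yP n (leqnn _).
have {}xt : x `&` pcompl (y n) <= t.
  by apply: IHn xt => k kn; apply: yP; rewrite ltnW.
have [_ yU _] := complemented_pcompl yC.
rewrite -[x]meetx1 -yU meetUr leUx xt andbT; exact: le_trans (leIr _ _) yt.
Qed.

(** The reduction argument: write [a] and [b] as joins of sequences [w] and [z]
    of complemented elements and cut off from each term the earlier terms of
    the other sequence. This makes the two sequences disjoint without changing
    the total join. *)
Lemma Coz_separation a b : strongly_zero_dimensional L ->
  Coz a -> Coz b -> a `|` b = \top ->
  exists c c', [/\ c `&` c' = \bot, c `|` c' = \top, c <= b & c' <= a].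
Proof.
move=> [_ Ls] /Ls[A [Ac AC ->]] /Ls[B [Bc BC ->]].
have [w wC ->] := countable_range Ac AC.
have [z zC ->] := countable_range Bc BC => wz.
(* The asymmetry of the bounds (k <= n here, k < n below) settles u n against
   v n: every pair of terms is cut exactly once. *)
pose u n := z n `&` \meet_(k < n.+1) pcompl (w k).
pose v n := w n `&` \meet_(k < n) pcompl (z k).
exists (Sup (range u)), (Sup (range v)); split.
- apply/eqP; rewrite -lex0 meetSup; apply: Sup_le => _ [_ [m _ <-] <-].
  rewrite meetC meetSup; apply: Sup_le => _ [_ [n _ <-] <-].
  have [mn|nm] := leqP m n.
    rewrite -(meet_pcompl (w m)); apply: leI2; first exact: leIl.
    apply: le_trans (leIr _ _) _.
    have mn1 := mn : (m < n.+1)%N.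
    exact: (@meets_inf _ _ _ (Ordinal mn1) xpredT (fun k => pcompl (w k))).
  rewrite meetC -(meet_pcompl (z n)); apply: leI2; first exact: leIl.
  apply: le_trans (leIr _ _) _.
  exact: (@meets_inf _ _ _ (Ordinal nm) xpredT (fun k => pcompl (z k))).
- set t := _ `|` _; apply/eqP; rewrite -le1x -wz.
  have ut n : u n <= t by apply: le_trans (leUl _ _); apply: Sup_ub; exists n.
  have vt n : v n <= t by apply: le_trans (leUr _ _); apply: Sup_ub; exists n.
  suff zwt n : forall k, (k < n)%N -> z k <= t /\ w k <= t.
    rewrite leUx; apply/andP; split; apply: Sup_le => _ [n _ <-];
      by have [] := zwt n.+1 n (leqnn _).
  elim: n => // n IHn.
  have wt : w n <= t.
    by apply: le_meet_pcompl (vt n) => k /IHn[].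
  have zt : z n <= t.
    apply: le_meet_pcompl (ut n) => k; rewrite ltnS leq_eqVlt.
    by move=> /predU1P[->|/IHn[]].
  by move=> k; rewrite ltnS leq_eqVlt => /predU1P[->|/IHn].
- apply: Sup_le => _ [n _ <-]; apply: le_trans (leIl _ _) _.
  by apply: Sup_ub; exists n.
- apply: Sup_le => _ [n _ <-]; apply: le_trans (leIl _ _) _.
  by apply: Sup_ub; exists n.
Qed.

Import GRing.Theory Num.Theory.

Lemma completely_below_pcompl x y :
  completely_below x y -> completely_below (pcompl y) (pcompl x).
Proof.
move=> [c [c0 c1 cP]].
exists (fun q => pcompl (c (1 - q)%R)); rewrite subr0 subrr c0 c1.
split=> // p q p0 pq q1; rewrite joinC.
apply/eqP; rewrite -le1x.
rewrite -(cP (1 - q) (1 - p))%R; last 3 first.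
- by rewrite subr_ge0.
- by rewrite ltrD2l ltrN2.
- by rewrite gerBl.
by apply: leU2 => //; exact: le_pcomplK.
Qed.

Lemma completely_below_scale (c : rat -> L) p q :
  (forall p q : rat, (0 <= p)%R -> (p < q)%R -> (q <= 1)%R ->
    pcompl (c p) `|` c q = \top) ->
  (0 <= p)%R -> (p < q)%R -> (q <= 1)%R -> completely_below (c p) (c q).
Proof.
move=> cP p0 pq q1; have qp0 : (0 < q - p)%R by rewrite subr_gt0.
exists (fun t => c (p + t * (q - p))%R).
rewrite mul0r addr0 mul1r addrC subrK; split=> // s t s0 st t1; apply: cP.
- by rewrite addr_ge0// mulr_ge0// ltW.
- by rewrite ltrD2l ltr_pM2r.
- apply: le_trans q1; rewrite -lerBrDl -[leRHS]mul1r.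
  by rewrite ler_wpM2r// ltW.
Qed.

(** Along a chain [c] from [x] to [y], the join [z] of terms approaching [y] and
    the join [w] of pseudocomplements of terms approaching [x] are cozero
    elements covering the top, with [z <= y] and [w] disjoint from [x].
    Separating them gives the complemented element. *)
Lemma completely_below_interpolation x y : strongly_zero_dimensional L ->
  completely_below x y -> exists c, [/\ complemented c, x <= c & c <= y].
Proof.
move=> Ls [c [c0 c1 cP]].
(* Starting the sequence at 1/2 makes both n |-> e n and n |-> 1 - e n stay
   inside the unit interval, and e 1 < 1 - e 0 is what makes w and z cover. *)
pose e n : rat := (n.+2%:R^-1)%R.
have e0 n : (0 < e n)%R by rewrite invr_gt0 ltr0n.
have eS n : (e n.+1 < e n)%R by rewrite ltf_pV2 ?posrE ?ltr0n// ltr_nat.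
have e1 n : (e n < 1)%R by rewrite invf_lt1 ?ltr0n// ltr1n.
pose z := Sup (range (fun n => c (1 - e n)%R)).
pose w := Sup (range (fun n => pcompl (c (e n)))).
have zC : Coz z.
  exists (fun n => c (1 - e n)%R) => // n; apply: completely_below_scale => //.
  - by rewrite subr_ge0 ltW.
  - by rewrite ltrD2l ltrN2.
  - by rewrite gerBl ltW.
have wC : Coz w.
  exists (fun n => pcompl (c (e n))) => // n.
  apply: completely_below_pcompl.
  by apply: completely_below_scale => //; exact: ltW.
have wz : w `|` z = \top.
  have e10 : (e 1%N < 1 - e 0%N)%R.
    by rewrite ltrBrDr [ltRHS]splitr mul1r ltrD2r; exact: eS.
  have e01 : (1 - e 0%N <= 1)%R by rewrite gerBl ltW.
  apply/eqP; rewrite -le1x -(cP _ _ (ltW (e0 1%N)) e10 e01).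
  by apply: leU2; apply: Sup_ub; [exists 1%N|exists 0%N].
have [k [k' [kI kU kz kw]]] := Coz_separation Ls wC zC wz.
exists k; split; first by exists k'.
  rewrite -[x]meetx1 -kU meetUr leUx leIr /=.
  apply: le_trans (leI2 (lexx x) kw) _.
  rewrite meetSup; apply: Sup_le => _ [_ [n _ <-] <-].
  suff /leI2/(_ (lexx (pcompl (c (e n)))))/le_trans : x <= c (e n).
    by apply; rewrite meet_pcompl le0x.
  rewrite -c0; apply/completely_below_le/completely_below_scale => //.
  exact: ltW.
apply: le_trans kz _; apply: Sup_le => _ [n _ <-]; rewrite -c1.
apply/completely_below_le/completely_below_scale => //.
  by rewrite subr_ge0 ltW.
by rewrite gtrBl.
Qed.

End Separation.

(** * Frames with a base of complemented elements isomorphic to [CL] *)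

Section ComplementedBase.
Context d d' (L : frameType d) (M : frameType d') (e : CL L -> M).
Hypothesis e_mono : {mono e : u v / u <= v}.
Hypothesis e_compl : forall u, complemented (e u).
Hypothesis e_base : forall x : M, x = Sup [set e u | u in [set u | e u <= x]].
Hypothesis e_between : forall x y : M, pcompl x `|` y = \top ->
  exists2 u, x <= e u & e u <= y.

(** Interpolating members of the base in a cozero sequence gives a sequence in
    the base with the same join. *)
Lemma base_strongly_zero_dimensional : strongly_zero_dimensional M.
Proof.
split=> [x|x [a aP ->]].
  by exists [set e u | u in [set u | e u <= x]] => // _ [u _ <-].
have /boolp.choice[u uP] n : exists u, a n <= e u /\ e u <= a n.+1.
  have [c [c0 c1 cP]] := aP n.
  have [|v av va] := @e_between (a n) (a n.+1); last by exists v.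
  by rewrite -c0 -c1; exact: cP.
exists (range (e \o u)); split.
- by apply: countable_image; exact: countableP.
- by move=> _ [n _ <-]; exact: e_compl.
- apply/le_anti/andP; split; apply: Sup_le => _ [n _ <-].
    by have [an _] := uP n; apply: le_trans an _; apply: Sup_ub; exists n.
  by have [_ an] := uP n; apply: le_trans an _; apply: Sup_ub; exists n.+1.
Qed.

(** A complemented [k] is rather below itself, so a member of the base lies
    between [k] and [k]: the embedding is onto the complemented elements. *)
Lemma base_countably_bounded :
  countably_bounded (CL L) <-> countably_bounded (CL M).
Proof.
pose f u : CL M := exist _ (e u) (mem_set (e_compl u)).
apply: (@countably_bounded_iso _ _ _ _ f) => [u v|k].
  by rewrite leEsub e_mono.
have [_ kU _] := complemented_pcompl (set_mem (valP k)).
have [|u ku uk] := @e_between (val k) (val k); first by rewrite joinC.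
by exists u; apply: val_inj; apply/le_anti; rewrite /= ku uk.
Qed.

Lemma base_coole : strongly_zero_dimensional L -> coole L <-> coole M.
Proof.
move=> Ls; rewrite (coole_countably_bounded Ls) base_countably_bounded.
by rewrite -(coole_countably_bounded base_strongly_zero_dimensional).
Qed.

End ComplementedBase.

(** * The Lindelof coreflection *)

Section LindelofCoole.
Context d (L : frameType d).
Implicit Types (I J K : lindelof L) (x y : L) (u v : CL L).

Fact lindelof_principal_subproof x : sigma_ideal [set z | Coz z /\ z <= x].
Proof.
split=> [z []//|z t tC tz [_ zx]|A Ac AI].
  by split=> //; exact: le_trans zx.
by split; [apply: Coz_Sup => // z /AI[]|apply: Sup_le => z /AI[]].
Qed.

Definition lindelof_principal x : lindelof L :=
  in_subposet (lindelof_principal_subproof x).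

Lemma lindelof_principal_le x I :
  Coz x -> (lindelof_principal x <= I) <-> val I x.
Proof.
move=> xC; split=> [/lindelof_leP|Ix]; first by apply.
have [_ Id _] := lindelofP I.
by apply/lindelof_leP => z [zC zx]; exact: Id Ix.
Qed.

Lemma lindelof_in0 I : val I \bot.
Proof.
have [_ _ Is] := lindelofP I.
have -> : \bot = Sup (set0 : set L) by apply/eqP; rewrite eq_sym -lex0 Sup_le.
exact: Is.
Qed.

Lemma lindelof_inU I x y : val I x -> val I y -> val I (x `|` y).
Proof.
move=> Ix Iy; have [_ _ Is] := lindelofP I.
have -> : x `|` y = Sup [set x; y].
  apply/le_anti; rewrite leUx !Sup_ub ?Sup_le//=; try by [left|right].
  by move=> _ [->|->]; rewrite ?leUl ?leUr.
apply: Is => [|_ [->|->]//].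
exact/finite_set_countable/finite_set2.
Qed.

(** The elements below some [i `|` j] form a sigma-ideal that contains both [I]
    and [J], hence all of their join. *)
Lemma lindelof_join I J x : val (I `|` J) x ->
  exists i j, [/\ val I i, val J j & x <= i `|` j].
Proof.
have [[IC Id Is] [JC Jd Js]] := (lindelofP I, lindelofP J).
have Ksub : sigma_ideal
    [set x | Coz x /\ exists i j, [/\ val I i, val J j & x <= i `|` j]].
  split=> [y []//|y z zC zy [yC [i [j [Ii Jj yij]]]]|A Ac AK].
    by split=> //; exists i, j; split=> //; exact: le_trans yij.
  split; first by apply: Coz_Sup => // y /AK[].
  have /boolp.choice[ij ijP] y : exists ij : L * L, A y ->
      [/\ val I ij.1, val J ij.2 & y <= ij.1 `|` ij.2].
    have [/AK[_ [i [j ij]]]|nA] := pselect (A y); first by exists (i, j).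
    by exists (\bot, \bot).
  exists (Sup [set (ij y).1 | y in A]), (Sup [set (ij y).2 | y in A]); split.
  - by apply: Is => [|_ [y /ijP[] ? ? ? <-]//]; exact: countable_image.
  - by apply: Js => [|_ [y /ijP[] ? ? ? <-]//]; exact: countable_image.
  - apply: Sup_le => y Ay; have [_ _ yij] := ijP y Ay; apply: le_trans yij _.
    by apply: leU2; apply: Sup_ub; exists y.
have /lindelof_leP IJK : I `|` J <= in_subposet Ksub.
  rewrite leUx; apply/andP; split; apply/lindelof_leP => y yH.
    split; first exact: IC.
    by exists y, \bot; rewrite joinx0; split=> //; exact: lindelof_in0.
  split; first exact: JC.
  by exists \bot, y; rewrite join0x; split=> //; exact: lindelof_in0.
by move=> /IJK[].
Qed.

Lemma lindelof_bot x : val (\bot : lindelof L) x -> x = \bot.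
Proof.
have /lindelof_leP B := le0x (lindelof_principal \bot).
by move=> /B[_]; rewrite lex0 => /eqP.
Qed.

Lemma lindelof_eq_bot I : (forall x, val I x -> x = \bot) -> I = \bot.
Proof.
move=> I0; apply/eqP; rewrite -lex0; apply/lindelof_leP => x /I0 ->.
exact: lindelof_in0.
Qed.

Lemma lindelof_eq_top I : val I \top <-> I = \top.
Proof.
split=> [I1|->].
  apply/eqP; rewrite -le1x; apply/lindelof_leP => x xT.
  have [_ Id _] := lindelofP I; apply: Id (lex1 x) I1.
  by have [TC _ _] := lindelofP (\top : lindelof L); exact: TC.
have /lindelof_leP : lindelof_principal \top <= \top by exact: lex1.
by apply; split=> //; exact: Coz_top.
Qed.

(** If [I^* \/ J] is the top, then [a `|` b = \top] for cozero elements [a] of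
    [I^*] and [b] of [J]; a complemented element separating them generates a
    sigma-ideal between [I] and [J]. *)
Lemma lindelof_coole :
  strongly_zero_dimensional L -> coole L <-> coole (lindelof L).
Proof.
move=> Ls.
pose e u := lindelof_principal (val u).
have CLC u : Coz (val u) by apply/complemented_Coz/set_mem/(valP u).
have [Lz Lc] := Ls.
apply: (@base_coole _ _ _ _ e) => // [u v|u|I|I J IJ].
- apply/idP/idP => [/(lindelof_principal_le _ (CLC u))[_]|uv].
    by rewrite leEsub.
  by apply/lindelof_principal_le => //; split=> //; rewrite -leEsub.
- have [v uvI uvU] := CL_compl u; exists (e v).
    apply: lindelof_eq_bot => z [[zC zu] [_ zv]]; apply/eqP; rewrite -lex0.
    by have <- : val (u `&` v) = \bot; [rewrite uvI|rewrite lexI zu].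
  apply/lindelof_eq_top; have <- : val (u `|` v) = \top by rewrite uvU.
  apply: lindelof_inU; apply/lindelof_principal_le => //.
    exact: leUl.
  exact: leUr.
- apply/le_anti/andP; split; last by apply: Sup_le => _ [u /= ? <-].
  apply/lindelof_leP => x Ix; have [IC Id _] := lindelofP I.
  have [A [Ac AC xA]] := Lc x (IC x Ix); rewrite xA.
  have [_ _ Ss] := lindelofP (Sup [set e u | u in [set u | e u <= I]]).
  apply: Ss => // a Aa; have aC := complemented_Coz (AC a Aa).
  apply/lindelof_principal_le => //; apply: Sup_ub.
  exists (exist _ a (mem_set (AC a Aa))) => //=.
  by apply/lindelof_principal_le => //; apply: Id Ix => //; rewrite xA Sup_ub.
- have /lindelof_join[a [b [Ia Jb ab]]] : val (pcompl I `|` J) \top.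
    exact/lindelof_eq_top.
  have [[aC _ _] [JC Jd _]] := (lindelofP (pcompl I), lindelofP J).
  have [||||c [c' [cI cU cb ca]]] := @Coz_separation _ _ a b => //.
  + exact: aC.
  + exact: JC.
  + by apply/eqP; rewrite -le1x.
  have cC : complemented c by exists c'.
  have c'C : Coz c'.
    by apply: complemented_Coz; exists c; rewrite 1?meetC 1?joinC.
  exists (exist _ c (mem_set cC)); last first.
    apply/lindelof_principal_le; first exact: complemented_Coz.
    by apply: Jd cb Jb; exact: complemented_Coz.
  apply/lindelof_leP => x Ix.
  have [IC Id _] := lindelofP I; have [_ Pd _] := lindelofP (pcompl I).
  have xC := IC x Ix; split=> //=.
  suff xc' : x `&` c' = \bot.
    by rewrite -[x]meetx1 -cU meetUr xc' joinx0 leIr.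
  have xc'C : Coz (x `&` c') by exact: Coz_meet.
  apply: lindelof_bot; rewrite -(meet_pcompl I).
  split; first by apply: Id Ix => //; exact: leIl.
  by apply: Pd Ia => //; exact: le_trans (leIr _ _) ca.
Qed.

End LindelofCoole.

(** * The compact coreflection *)

Section StoneCechCoole.
Context d (L : frameType d).
Implicit Types (I J K : stone_cech L) (x y : L) (u v : CL L).

Fact stone_cech_principal_subproof u : regular_ideal [set z | z <= val u].
Proof.
split=> [|z zu].
  split=> [|x y yx xu|x y xu yu]; first exact: le0x.
    exact: le_trans xu.
  by rewrite /= leUx xu.
exists (val u) => //=; apply: completely_below_trans zu _ (lexx _).
exact/completely_below_complemented/set_mem/(valP u).
Qed.

Definition stone_cech_principal u : stone_cech L :=
  in_subposet (stone_cech_principal_subproof u).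

Lemma stone_cech_principal_le u I :
  (stone_cech_principal u <= I) <-> val I (val u).
Proof.
split=> [/stone_cech_leP|Iu]; first by apply => /=.
have [[_ Id _] _] := stone_cechP I.
by apply/stone_cech_leP => z zu; exact: Id Iu.
Qed.

(** As for sigma-ideals; regularity of the ideal of elements below some
    [i `|` j] comes from interpolating in [I] and [J] separately. *)
Lemma stone_cech_join I J x : val (I `|` J) x ->
  exists i j, [/\ val I i, val J j & x <= i `|` j].
Proof.
have [[[I0 _ IU] Ir] [[J0 _ JU] Jr]] := (stone_cechP I, stone_cechP J).
have Ksub : regular_ideal
    [set x | exists i j, [/\ val I i, val J j & x <= i `|` j]].
  split=> [|y [i [j [Ii Jj yij]]]]; last first.
    have [[i1 Ii1 ii1] [j1 Jj1 jj1]] := (Ir i Ii, Jr j Jj).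
    exists (i1 `|` j1); first by exists i1, j1.
    exact: completely_below_trans yij (completely_belowU ii1 jj1) (lexx _).
  split=> [|y z zy [i [j [Ii Jj yij]]]|].
  - by exists \bot, \bot; rewrite le0x.
  - by exists i, j; split=> //; exact: le_trans yij.
  - move=> y y' [i [j [Ii Jj yij]]] [i' [j' [Ii' Jj' yij']]].
    exists (i `|` i'), (j `|` j'); split; [exact: IU|exact: JU|].
    by rewrite joinACA; exact: leU2.
have /stone_cech_leP IJK : I `|` J <= in_subposet Ksub.
  rewrite leUx; apply/andP; split; apply/stone_cech_leP => y yH.
    by exists y, \bot; rewrite joinx0.
  by exists \bot, y; rewrite join0x.
by move=> /IJK.
Qed.

Lemma stone_cech_bot x : val (\bot : stone_cech L) x -> x = \bot.
Proof.
have /stone_cech_leP B := le0x (stone_cech_principal \bot).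
by move=> /B; rewrite /= lex0 => /eqP.
Qed.

Lemma stone_cech_eq_bot I : (forall x, val I x -> x = \bot) -> I = \bot.
Proof.
move=> I0; apply/eqP; rewrite -lex0; apply/stone_cech_leP => x /I0 ->.
by have [[]] := stone_cechP (\bot : stone_cech L).
Qed.

Lemma stone_cech_eq_top I : val I \top <-> I = \top.
Proof.
split=> [I1|->].
  apply/eqP; rewrite -le1x; apply/stone_cech_leP => x xT.
  by have [[_ Id _] _] := stone_cechP I; exact: Id (lex1 x) I1.
have /stone_cech_leP : stone_cech_principal \top <= \top by exact: lex1.
by apply=> /=.
Qed.

(** If [I^* \/ J] is the top, then [a `|` b = \top] with [a] in [I^*] and [b] in
    [J]; as [b] is completely below some element of [J], a complemented element
    of [J] lies above [b], hence above [I]. The same interpolation shows that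
    the principal ideals form a base. *)
Lemma stone_cech_coole :
  strongly_zero_dimensional L -> coole L <-> coole (stone_cech L).
Proof.
move=> Ls.
apply: (@base_coole _ _ _ _ stone_cech_principal) => // [u v|u|I|I J IJ].
- apply/idP/idP => [/stone_cech_principal_le|]; first by rewrite leEsub.
  by rewrite leEsub => uv; apply/stone_cech_principal_le.
- have [v uvI uvU] := CL_compl u; exists (stone_cech_principal v).
    apply: stone_cech_eq_bot => z [/= zu zv]; apply/eqP; rewrite -lex0.
    by have <- : val (u `&` v) = \bot; [rewrite uvI|rewrite lexI zu].
  apply/stone_cech_eq_top; have <- : val (u `|` v) = \top by rewrite uvU.
  set K := _ `|` _; have [[_ _ KU] _] := stone_cechP K.
  apply: KU; apply/stone_cech_principal_le; [exact: leUl|exact: leUr].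
- apply/le_anti/andP; split; last by apply: Sup_le => _ [u /= ? <-].
  set S := Sup _; apply/stone_cech_leP => x Ix.
  have [[_ Id _] Ir] := stone_cechP I; have [y Iy xy] := Ir x Ix.
  have [c [cC xc cy]] := completely_below_interpolation Ls xy.
  have [[_ Sd _] _] := stone_cechP S; apply: Sd xc _.
  pose u : CL L := exist _ c (mem_set cC).
  apply/(@stone_cech_principal_le u); apply: Sup_ub; exists u => //=.
  by apply/stone_cech_principal_le; exact: Id Iy.
- have /stone_cech_join[a [b [Ia Jb ab]]] : val (pcompl I `|` J) \top.
    exact/stone_cech_eq_top.
  have [[_ Jd _] Jr] := stone_cechP J; have [b' Jb' bb'] := Jr b Jb.
  have [c [cC bc cb']] := completely_below_interpolation Ls bb'.
  exists (exist _ c (mem_set cC)); last first.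
    by apply/stone_cech_principal_le; exact: Jd Jb'.
  apply/stone_cech_leP => x Ix /=; apply: le_trans bc.
  have [[_ Id _] _] := stone_cechP I.
  have [[_ Pd _] _] := stone_cechP (pcompl I).
  suff xa : x `&` a = \bot.
    rewrite -[x]meetx1; apply: le_trans (leI2 (lexx x) ab) _.
    by rewrite meetUr xa join0x leIr.
  apply: stone_cech_bot; rewrite -(meet_pcompl I).
  by split; [apply: Id Ix; exact: leIl|apply: Pd Ia; exact: leIr].
Qed.

End StoneCechCoole.

(** * The equivalence *)

Theorem theorem6p20 (d : Order.disp_t) (L : frameType d) :
  @strongly_zero_dimensional d L ->
  [<-> @coole d L;
       @CL_coole d L;
       poset_is_frame (subposet (bool_image (@Coz d L)));
       coole (lindelof L);
       coole (stone_cech L)].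
Proof.
move=> Ls; tfae.
- by move/(coole_countably_bounded Ls)/CL_coole_countably_bounded.
- move/CL_coole_countably_bounded/(coole_countably_bounded Ls).
  exact: coole_poset_is_frame.
- move/poset_is_frame_coole => Lc; apply/(lindelof_coole Ls)/Lc.
  by case: Ls.
- by move/(lindelof_coole Ls)/(stone_cech_coole Ls).
- by move/(stone_cech_coole Ls).
Qed.
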